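(* The asymptotic random order ratio of Best Fit satisfies $RR^\infty_{\mathrm{BF}} > 1.10$.
   Context: Bin packing: given a list $I=(x_1,\ldots,x_n)$ of items with sizes in $(0,1]$, a packing assigns items to unit-capacity bins so that the total size of items in each bin is at most $1$. $\mathrm{OPT}(I)$ denotes the minimum number of bins in a feasible packing. The online algorithm Best Fit (BF) processes the items in the given order and packs the current item into the fullest bin (largest current load) into which it fits, opening a new bin if it fits into no existing bin; items are never moved. $\mathrm{BF}(I)$ denotes the number of bins Best Fit uses on list $I$. For $\sigma\in\mathcal{S}_n$ (permutations of $[n]$), $I^\sigma=(x_{\sigma(1)},\ldots,x_{\sigma(n)})$. With $\mathcal{I}$ the set of all finite item lists and $\sigma$ uniformly random in $\mathcal{S}_n$ ($n$ the length of $I$), the asymptotic random order ratio is $$RR^\infty_{\mathrm{BF}}=\limsup_{k\to\infty}\ \sup_{I\in\mathcal{I}}\left\{\frac{\mathbb{E}[\mathrm{BF}(I^\sigma)]}{\mathrm{OPT}(I)} \;\middle|\; \mathrm{OPT}(I)=k\right\}.$$ *)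

(* Defs.v *)
From HB Require Import structures.
From mathcomp Require Import all_boot all_order all_algebra all_fingroup.
From mathcomp Require Import all_classical all_reals ereal topology normedtype sequences.
Set Implicit Arguments. Unset Strict Implicit. Unset Printing Implicit Defensive.
Import Order.TTheory GRing.Theory Num.Theory.
Local Open Scope ring_scope.

Section BinPacking.
Variable R : realType.

Definition valid_items (I : seq R) : Prop := forall x, x \in I -> 0 < x <= 1.

Definition packable (I : seq R) (m : nat) : bool :=
  [exists f : {ffun 'I_(size I) -> 'I_m},
     [forall j : 'I_m, \sum_(i : 'I_(size I) | f i == j) I`_i <= 1]].

Definition is_OPT (I : seq R) (k : nat) : Prop :=
  packable I k /\ forall m, (m < k)%N -> ~~ packable I m.

(* Best Fit.  The state is the sequence of bin loads (in order of opening).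
   The current item goes into a fullest bin it fits in (the first such bin
   in case of ties; ties do not affect the number of bins), or a new bin. *)
Definition bf_best (loads : seq R) (x : R) (cands : seq nat) (b : nat) : nat :=
  foldl (fun b i => if loads`_b < loads`_i then i else b) b cands.

Definition bf_step (loads : seq R) (x : R) : seq R :=
  let cands := [seq i <- iota 0 (size loads) | loads`_i + x <= 1] in
  match cands with
  | [::] => rcons loads x
  | i0 :: rest =>
      let b := bf_best loads x rest i0 in set_nth 0 loads b (loads`_b + x)
  end.

Definition BF (I : seq R) : nat := size (foldl bf_step [::] I).

Definition permute (I : seq R) (s : 'S_(size I)) : seq R :=
  [seq I`_(s i) | i <- enum 'I_(size I)].


Definition expected_BF (I : seq R) : R :=
  (\sum_(s : 'S_(size I)) (BF (@permute I s))%:R) / ((size I)`!)%:R.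

Definition sup_ratio (k : nat) : \bar R :=
  ereal_sup [set (expected_BF I / k%:R)%:E | I in [set I | valid_items I /\ is_OPT I k]].

Definition RR_BF : \bar R := limn_esup sup_ratio.

End BinPacking.

(* Main.v *)
(* Draw each of n items independently as 1/4 or 1/3 with probability 1/2.  The
   bins that can still receive an item then form a Markov chain with nine
   states, and a potential on the states shows that Best Fit opens on average at
   least 60/187 bins per item.  The optimum exceeds the total size, on average
   7n/24, by at most 2.  The law of the list is invariant under permutations, so
   the expected number of bins is an average over lists of the random order
   expectation; were the ratio at most 11/10, averaging over all lists would
   contradict (60/187) / (7/24) > 11/10. *)
Require Import Defs.
From HB Require Import structures.
From mathcomp Require Import all_boot all_order all_algebra all_fingroup.
From mathcomp Require Import all_classical all_reals ereal topology normedtype sequences.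
From mathcomp Require Import ring lra zify.
Import Order.TTheory GRing.Theory Num.Theory.
Local Open Scope ring_scope.
Local Open Scope ereal_scope.

Section BestFit.
Set Implicit Arguments.
Unset Strict Implicit.
Local Open Scope ring_scope.
Variable R : realType.
Implicit Types (loads I : seq R) (x l : R) (n : nat).

(** * Best Fit steps on the multiset of loads *)

Lemma bf_best_argmax loads x cands b (i := bf_best loads x cands b) :
  i \in b :: cands /\ {in b :: cands, forall j, loads`_j <= loads`_i}.
Proof.
rewrite {}/i; elim: cands b => [|c cands IH] b /=.
  by split=> [|j]; rewrite inE // => /eqP ->.
rewrite /bf_best /= -/(bf_best loads x cands _).
case: ltP => h; have [iin imax] := IH (if loads`_b < loads`_c then c else b).
- rewrite h in iin imax; split; first by rewrite inE iin orbT.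
  move=> j; rewrite inE => /predU1P[->|]; last exact: imax.
  by apply: le_trans (ltW h) (imax _ _); rewrite mem_head.
- rewrite ltNge h /= in iin imax; split.
    by move: iin; rewrite !inE => /predU1P[->|->]; rewrite ?eqxx ?orbT.
  move=> j; rewrite !inE => /or3P[/eqP ->|/eqP ->|jin].
  + by apply: imax; rewrite mem_head.
  + by apply: le_trans h (imax _ _); rewrite mem_head.
  + by apply: imax; rewrite inE jin orbT.
Qed.

Lemma bf_step_open loads x :
  {in loads, forall l, 1 < l + x} -> bf_step loads x = rcons loads x.
Proof.
move=> nofit; rewrite /bf_step; set cands := [seq i <- _ | _].
suff -> : cands = [::] by [].
apply/eqP; rewrite -[_ == _]negbK -has_filter; apply/hasPn => i.
by rewrite mem_iota /= => ilt; rewrite -ltNge nofit ?mem_nth.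
Qed.

(** Up to reordering, ties are harmless: the bin chosen may differ from the one singled out, but
    maximality on both sides forces its load to be [l]. *)
Lemma bf_step_fit loads s l x : perm_eq loads (l :: s) -> l + x <= 1 ->
  {in s, forall l', l' + x <= 1 -> l' <= l} ->
  perm_eq (bf_step loads x) (l + x :: s).
Proof.
move=> ls lx lmax.
have lin : l \in loads by rewrite (perm_mem ls) mem_head.
have {}lmax l' : l' \in loads -> l' + x <= 1 -> l' <= l.
  by rewrite (perm_mem ls) inE => /predU1P[->//|/lmax].
rewrite /bf_step; set cands := [seq i <- _ | _].
have candsP i : (i \in cands) = (loads`_i + x <= 1) && (i < size loads)%N.
  by rewrite mem_filter mem_iota.
have : index l loads \in cands by rewrite candsP nth_index // lx index_mem.
case: cands candsP => [|i0 rest] // candsP lcand.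
have [] := bf_best_argmax loads x rest i0.
set b := bf_best _ _ _ _; rewrite candsP => /andP[bx blt] /(_ _ lcand).
rewrite nth_index // => lb.
have bl : loads`_b = l by apply/eqP; rewrite eq_le lb lmax ?mem_nth.
rewrite bl set_nthE blt -cat_rcons -cats1 -catA perm_catCA /= perm_cons.
rewrite -(perm_cons l); apply: perm_trans ls.
rewrite -[X in perm_eq _ X](cat_take_drop b) (drop_nth 0 blt) bl.
by rewrite -[l :: drop _ _]cat1s perm_sym perm_catCA.
Qed.

(** * Open bins and their Markov chain for items 1/4 and 1/3 *)

Definition item (b : bool) : R := if b then 1 / 4 else 1 / 3.

(* Bins filled above 3/4 accept no further item, so only the other ones matter. *)
Definition open_loads (os loads : seq R) : Prop :=
  exists2 C, perm_eq loads (os ++ C) & {in C, forall l, 3 / 4 < l}.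

Lemma item_ge b : 1 / 4 <= item b.
Proof. by case: b; rewrite /item; lra. Qed.

Lemma open_loads_close l os loads :
  3 / 4 < l -> open_loads (l :: os) loads -> open_loads os loads.
Proof.
move=> lfull [C loadsE Cfull]; exists (l :: C) => [|l'].
  by apply: perm_trans loadsE _; rewrite -[l :: C]cat1s perm_sym perm_catCA.
by rewrite inE => /predU1P[->|/Cfull].
Qed.

Lemma open_loads_new os loads b : open_loads os loads ->
  {in os, forall l, 1 < l + item b} ->
  open_loads (item b :: os) (bf_step loads (item b)) /\
  size (bf_step loads (item b)) = (size loads).+1.
Proof.
move=> [C loadsE Cfull] nofit; rewrite bf_step_open ?size_rcons.
  by split=> //; exists C; rewrite // perm_rcons /= perm_cons.
move=> l; rewrite (perm_mem loadsE) mem_cat => /orP[/nofit//|/Cfull].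
by have := item_ge b; lra.
Qed.

(** Bins above 3/4 cannot take an item of size at least 1/4, so only [os] competes with [l]. The
    variable [y] lets the new load match a literal of [stage_loads]. *)
Lemma open_loads_fit l os loads b y : open_loads (l :: os) loads ->
  l + item b = y -> y <= 1 ->
  {in os, forall l', l' + item b <= 1 -> l' <= l} ->
  open_loads (y :: os) (bf_step loads (item b)) /\
  size (bf_step loads (item b)) = size loads.
Proof.
move=> [C loadsE Cfull] <- fit lmax.
have stepE : perm_eq (bf_step loads (item b)) (l + item b :: os ++ C).
  apply: bf_step_fit loadsE fit _ => l'.
  rewrite mem_cat => /orP[/lmax//|/Cfull] ? ?.
  by have := item_ge b; lra.
split; first by exists C.
by rewrite (perm_size stepE) (perm_size loadsE).
Qed.

Lemma open_loadsC l1 l2 loads :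
  open_loads [:: l1; l2] loads -> open_loads [:: l2; l1] loads.
Proof.
move=> [C loadsE Cfull]; exists C => //.
by apply: perm_trans loadsE _; rewrite (perm_catCA [:: l1] [:: l2]).
Qed.

(* [Sk] has one open bin, of load k/12; [S9k] has two, of loads 9/12 and k/12. *)
Inductive stage := S0 | S3 | S4 | S6 | S7 | S8 | S9 | S94 | S98.

Definition stage_loads s : seq R :=
  match s with
  | S0 => [::] | S3 => [:: 1 / 4] | S4 => [:: 1 / 3] | S6 => [:: 1 / 2]
  | S7 => [:: 7 / 12] | S8 => [:: 2 / 3]
  | S9 => [:: 3 / 4] | S94 => [:: 1 / 3; 3 / 4] | S98 => [:: 2 / 3; 3 / 4]
  end.

Definition next s (b : bool) : stage :=
  match s, b with
  | S0, true => S3 | S0, false => S4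
  | S3, true => S6 | S3, false => S7
  | S4, true => S7 | S4, false => S8
  | S6, true => S9  | S6, false => S0
  | S7, _ => S0    | S8, _ => S0
  | S9, true => S0  | S9, false => S94
  | S94, true => S4 | S94, false => S98
  | S98, true => S8 | S98, false => S9
  end.

Definition opens s (b : bool) : nat :=
  match s, b with S0, _ => 1 | S9, false => 1 | _, _ => 0 end%N.

(* 187 times the solution of the Poisson equation of the stage chain under fair
   coin flips; in the long run 60/187 bins are opened per item. *)
Definition potential s : R :=
  match s with
  | S0 => 0 | S3 => - 134 | S4 => - 120 | S6 => - 88 | S7 => - 60
  | S8 => - 60 | S9 => - 56 | S94 => - 179 | S98 => - 118
  end.

(** Equality holds at each of the nine stages, so 60/187 is the exact rate of the chain. *)
Lemma potential_next s :
  2 * (60 + potential s) <=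
  \sum_(b : bool) (187 * (opens s b)%:R + potential (next s b)).
Proof. by rewrite big_bool; case: s => /=; lra. Qed.

(** The potential is normalised to have its maximum 0 at [S0]: a lower bound can then drop the final
    potential, and the empty start costs nothing. *)
Lemma potential_le0 s : potential s <= 0.
Proof. by case: s => /=; lra. Qed.

Lemma stage_step s b loads : open_loads (stage_loads s) loads ->
  open_loads (stage_loads (next s b)) (bf_step loads (item b)) /\
  size (bf_step loads (item b)) = (size loads + opens s b)%N.
Proof.
have fit1 l y : open_loads [:: l] loads -> l + item b = y -> y <= 1 ->
    open_loads [:: y] (bf_step loads (item b)) /\
    size (bf_step loads (item b)) = (size loads + 0)%N.
  by move=> oloads lE y1; rewrite addn0; apply: open_loads_fit oloads lE y1 _.
have fit1_full l : open_loads [:: l] loads -> 3 / 4 < l + item b <= 1 ->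
    open_loads [::] (bf_step loads (item b)) /\
    size (bf_step loads (item b)) = (size loads + 0)%N.
  move=> oloads /andP[lo hi]; have [st ->] := fit1 _ _ oloads erefl hi.
  by split=> //; apply: open_loads_close st.
have fit2 l1 l2 y : open_loads [:: l1; l2] loads -> l1 + item b = y -> y <= 1 ->
    (l2 + item b <= 1 -> l2 <= l1) ->
    open_loads [:: y; l2] (bf_step loads (item b)) /\
    size (bf_step loads (item b)) = (size loads + 0)%N.
  move=> oloads lE y1 le21; rewrite addn0.
  by apply: open_loads_fit oloads lE y1 _ => l'; rewrite inE => /eqP ->.
have fit2_full l1 l2 : open_loads [:: l1; l2] loads -> 3 / 4 < l1 + item b <= 1 ->
    (l2 + item b <= 1 -> l2 <= l1) ->
    open_loads [:: l2] (bf_step loads (item b)) /\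
    size (bf_step loads (item b)) = (size loads + 0)%N.
  move=> oloads /andP[lo hi] le21; have [st ->] := fit2 _ _ _ oloads erefl hi le21.
  by split=> //; apply: open_loads_close st.
have new os : open_loads os loads -> {in os, forall l, 1 < l + item b} ->
    open_loads (item b :: os) (bf_step loads (item b)) /\
    size (bf_step loads (item b)) = (size loads + 1)%N.
  by rewrite addn1; apply: open_loads_new.
case: s; case: b fit1 fit1_full fit2 fit2_full new
  => /= fit1 fit1_full fit2 fit2_full new oloads;
  rewrite /item in fit1 fit1_full fit2 fit2_full new *.
all: try by [apply: new oloads _ | apply: fit1 oloads _ _; lra
  | apply: fit1_full oloads _; lra
  | apply: fit2 oloads _ _ _ => [||h]; lra
  | apply: fit2_full oloads _ _ => [|h]; lra
  (* In [S94] and [S98] an item 1/4 completes the bin of load 3/4, which is listed second. *)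
  | apply: fit2_full (open_loadsC oloads) _ _ => [|h]; lra].
(* What remains is [S9] with an item 1/3, where 3/4 + 1/3 > 1. *)
all: try by apply: new oloads _ => l; rewrite inE => /eqP ->; lra.
Qed.

(** * Average number of Best Fit bins over binary words *)

Lemma big_tuple_cons n (F : seq bool -> R) :
  \sum_(t : n.+1.-tuple bool) F t = \sum_(b : bool) \sum_(t : n.-tuple bool) F (b :: t).
Proof.
rewrite pair_big /= (reindex (fun p : bool * n.-tuple bool => cons_tuple p.1 p.2)) //=.
exists (fun t => (thead t, behead_tuple t)) => [[b t] _|t _].
  by congr pair; apply: val_inj.
by case/tupleP: t => b t; apply: val_inj.
Qed.

(** Induction on the first item, from an arbitrary stage: [potential_next] accounts for one coin
    flip and [potential_le0] ends the telescoping. *)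
Lemma sum_BF_ge_loads n s loads : open_loads (stage_loads s) loads ->
  2 ^+ n * (187 * (size loads)%:R + 60 * n%:R + potential s) <=
  187 * \sum_(t : n.-tuple bool) (size (foldl (@bf_step R) loads (map item t)))%:R.
Proof.
elim: n s loads => [|n IH] s loads oloads.
  rewrite expr0 mul1r (big_pred1 [tuple]) => [|t]; last exact/esym/eqP/tuple0.
  by rewrite /=; have := potential_le0 s; lra.
rewrite (big_tuple_cons n (fun w => (size (foldl (@bf_step R) loads (map item w)))%:R)).
rewrite mulr_sumr.
apply: le_trans (_ : \sum_(b : bool) 2 ^+ n * (187 * (size loads + opens s b)%:R
    + 60 * n%:R + potential (next s b)) <= _); last first.
  apply: ler_sum => b _; have [stb sizeb] := stage_step b oloads.
  by rewrite -sizeb /=; apply: IH stb.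
have := potential_next s; rewrite -mulr_sumr !big_bool /= exprS -mulrA mulrCA => pn.
apply: ler_wpM2l; first exact: exprn_ge0.
by rewrite !natrD mulrSr; lra.
Qed.

Lemma sum_BF_ge n :
  2 ^+ n * (60 * n%:R) <= 187 * \sum_(t : n.-tuple bool) (BF (map item t))%:R :> R.
Proof.
have := @sum_BF_ge_loads n S0 [::]; rewrite /= mulr0 add0r addr0; apply.
by exists [::].
Qed.

(** * Random order expectation averaged over words *)

(** The type ['S_(size I)] depends on the list; a common ['S_n] for all words of length [n] allows
    the sums over words and permutations to be exchanged. *)
Lemma expected_BF_sized n I : size I = n ->
  expected_BF I =
  (\sum_(s : 'S_n) (BF [seq I`_(s i) | i <- enum 'I_n])%:R) / n`!%:R.
Proof. by move=> <-. Qed.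

(* Permuting the positions is a bijection on words of length n. *)
Lemma sum_expected_BF (T : finType) (f : T -> R) n :
  \sum_(t : n.-tuple T) expected_BF (map f t) =
  \sum_(t : n.-tuple T) (BF (map f t))%:R.
Proof.
under eq_bigr => t _ do rewrite (@expected_BF_sized n) ?size_map ?size_tuple //.
rewrite -mulr_suml exchange_big /=.
transitivity ((\sum_(s : 'S_n) \sum_(t : n.-tuple T) (BF (map f t))%:R) / n`!%:R : R).
  congr (_ / _); apply: eq_bigr => s _.
  rewrite [RHS](reindex (fun t : n.-tuple T => [tuple tnth t (s i) | i < n])) /=.
    apply: eq_bigr => t _; congr (BF _)%:R; rewrite -map_comp; apply: eq_map => i /=.
    by rewrite (tnth_nth (tnth t i)) (nth_map (tnth t i)) ?size_tuple.
  exists (fun t : n.-tuple T => [tuple tnth t (s^-1%g i) | i < n]) => t _;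
    by apply: eq_from_tnth => i; rewrite !tnth_mktuple ?permK ?permKV.
by rewrite sumr_const card_Sn -[X in X / _]mulr_natr mulfK //.
Qed.

(** * Optimal packings of words *)

Lemma packable_sized n m I (f : 'I_n -> 'I_m) : size I = n ->
  (forall j, \sum_(i < n | f i == j) I`_i <= 1) -> packable I m.
Proof.
move=> sizeI; case: _ / sizeI f => f fP; apply/existsP; exists (finfun f).
by apply/forallP => j; under eq_bigl => i do rewrite ffunE; apply: fP.
Qed.

Lemma packable_ge_total I m : packable I m -> \sum_(x <- I) x <= m%:R.
Proof.
case/existsP => f /forallP fP; rewrite (big_nth 0) big_mkord.
rewrite (partition_big f xpredT) //= -[m in m%:R]card_ord -sumr_const.
exact: ler_sum.
Qed.

Lemma is_OPT_exists I m : packable I m -> exists2 k, is_OPT I k & (k <= m)%N.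
Proof.
move=> Im; have exI : exists k, packable I k by exists m.
case: (ex_minnP exI) => k Ik kmin; exists k; last exact: kmin.
by split=> // l lk; apply/negP => /kmin; rewrite leqNgt lk.
Qed.

Lemma count_take_lt (T : Type) (a : pred T) (x0 : T) (s : seq T) i j :
  (i < j)%N -> (i < size s)%N -> a (nth x0 s i) ->
  (count a (take i s) < count a (take j s))%N.
Proof.
move=> ij isz ai.
rewrite -[take j s](cat_take_drop i.+1) take_takel // count_cat.
by rewrite (take_nth x0) // -cats1 count_cat /= ai addn1 addSn ltnS leq_addr.
Qed.

(* Numbering the entries satisfying [a] from left to right and cutting them
   into consecutive blocks of [c], this bounds the size of block [j]. *)
Lemma card_count_block (T : Type) (a : pred T) (x0 : T) (s : seq T) c j :
  (0 < c)%N ->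
  (#|[pred i : 'I_(size s) | a (nth x0 s i) &
        (count a (take i s) %/ c == j)%N]| <= c)%N.
Proof.
case: c => // c _; set B := [pred i | _].
(* Inside one block the quotient of the rank is fixed, so its remainder determines the rank, and
   ranks of entries satisfying [a] are distinct. *)
pose g (i : 'I_(size s)) : 'I_c.+1 := inord (count a (take i s) %% c.+1).
rewrite -[leqRHS]card_ord -(card_in_image (f := g)) ?max_card //.
move=> i k /andP[ai /eqP qi] /andP[ak /eqP qk] /(congr1 val).
rewrite /= !inordK ?ltn_pmod // => rE.
have cE : count a (take i s) = count a (take k s).
  by rewrite (divn_eq (count _ (take i s)) c.+1) qi rE -qk -divn_eq.
apply: val_inj; case: (ltngtP i k) => // [ik|ki].
- by have := count_take_lt ik (ltn_ord i) ai; rewrite cE ltnn.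
- by have := count_take_lt ki (ltn_ord k) ak; rewrite cE ltnn.
Qed.

(** The right-hand side is [q] divided by [c.+1], rounded up: the number of blocks needed for ranks
    below [q]. *)
Lemma ltn_div_ceil r q c : (r < q)%N -> (r %/ c.+1 < (q + c) %/ c.+1)%N.
Proof. by move=> rq; rewrite leq_divRL // mulSn; have := leq_divM r c.+1; lia. Qed.

(** Kinds are packed separately, four quarters or three thirds to a bin; the bins of thirds are
    numbered after those of quarters. *)
Lemma packable_word (w : seq bool) (q := count_mem true w) (t := count_mem false w) :
  packable (map item w) ((q + 3) %/ 4 + (t + 2) %/ 3).
Proof.
pose cap (b : bool) := if b then 4%N else 3%N.
pose blk (i : 'I_(size w)) :=
  let b := nth true w i in (count_mem b (take i w) %/ cap b)%N.
have cnt_lt (i : 'I_(size w)) b : nth true w i = b ->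
    (count_mem b (take i w) < count_mem b w)%N.
  move=> ib; have := @count_take_lt _ (pred1 b) true w i (size w).
  by rewrite take_size ltn_ord /= ib eqxx; apply.
have blkP (i : 'I_(size w)) :
    (blk i < if nth true w i then (q + 3) %/ 4 else (t + 2) %/ 3)%N.
  rewrite /blk /=; case E: (nth true w i); have := cnt_lt i _ E;
    exact: ltn_div_ceil.
have fsP (i : 'I_(size w)) :
   ((if nth true w i then blk i else (q + 3) %/ 4 + blk i) < (q + 3) %/ 4 + (t + 2) %/ 3)%N.
  by have := blkP i; case: (nth true w i) => h; rewrite ?ltn_add2l // ltn_addr.
apply: (@packable_sized _ _ _ (fun i => Ordinal (fsP i))); first by rewrite size_map.
(* Bin [j] holds only items of kind [b], namely block [j'] of that kind. *)
move=> j; pose b := (j < (q + 3) %/ 4)%N.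
pose j' := (if b then j : nat else j - (q + 3) %/ 4)%N.
apply: (@le_trans _ _ (\sum_(i < size w |
    (nth true w i == b) && (count_mem b (take i w) %/ cap b == j')%N) item b)).
  rewrite le_eqVlt; apply/orP; left; apply/eqP.
  rewrite [LHS](eq_bigr (fun i : 'I_(size w) => item (nth true w i))); last first.
    by move=> i _; rewrite (nth_map true).
  apply: eq_big => [i|i /eqP/(congr1 val)/= fij].
    rewrite -val_eqE /= /j' /b; have := blkP i; rewrite /blk /cap.
    case: (nth true w i) => /= h; case: (ltnP j) => hj //=.
    - by rewrite ltn_eqF // (leq_trans h hj).
    - by rewrite gtn_eqF // ltn_addr.
    - by rewrite -{1}(subnKC hj) eqn_add2l.
  have := blkP i; rewrite /b -fij; case E: (nth true w i) => h; first by rewrite h.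
  by rewrite ltnNge leq_addr.
rewrite sumr_const; apply: (@le_trans _ _ (item b *+ cap b)); last first.
  by rewrite /item /cap; case: (b); lra.
apply: ler_wpMn2l; first by have := item_ge b; lra.
by apply: (@card_count_block _ (pred1 b)); case: (b).
Qed.

Lemma total_word w : \sum_(x <- map item w) x =
  (count_mem true w)%:R / 4 + (count_mem false w)%:R / 3.
Proof.
rewrite big_map; elim: w => [|b w IH]; first by rewrite big_nil /=; lra.
by rewrite big_cons IH; case: b; rewrite /item /= !natrD; lra.
Qed.

Lemma total_word_ge w : (size w)%:R / 4 <= \sum_(x <- map item w) x.
Proof.
rewrite total_word -(count_predC (pred1 true) w) natrD.
rewrite (@eq_count _ (predC (pred1 true)) (pred1 false)); last by case.
have : 0 <= (count_mem false w)%:R :> R by [].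
lra.
Qed.

(** Rounding up the two bin counts adds at most 3/4 + 2/3 < 2 to the total size. *)
Lemma is_OPT_word w : exists2 k, is_OPT (map item w) k &
  \sum_(x <- map item w) x <= k%:R <= \sum_(x <- map item w) x + 2.
Proof.
have [k optk kle] := is_OPT_exists (packable_word w).
exists k => //; rewrite (packable_ge_total (proj1 optk)) /= total_word.
have q4 : ((count_mem true w + 3) %/ 4)%:R * 4 <= (count_mem true w)%:R + 3 :> R.
  by rewrite -natrM -natrD ler_nat leq_divM.
have t3 : ((count_mem false w + 2) %/ 3)%:R * 3 <= (count_mem false w)%:R + 2 :> R.
  by rewrite -natrM -natrD ler_nat leq_divM.
have : k%:R <= ((count_mem true w + 3) %/ 4)%:R + ((count_mem false w + 2) %/ 3)%:R :> R.
  by rewrite -natrD ler_nat.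
lra.
Qed.

(** * Upper bound on the average under an assumed ratio *)

Lemma sum_total_words n :
  \sum_(t : n.-tuple bool) \sum_(x <- map item t) x = 2 ^+ n * (7 / 24 * n%:R).
Proof.
elim: n => [|n IH].
  by rewrite big1 ?mulr0 // => t _; rewrite (tuple0 t) big_nil.
rewrite (big_tuple_cons n (fun w => \sum_(x <- map item w) x)) big_bool /=.
under eq_bigr do rewrite big_cons.
under [X in _ + X]eq_bigr do rewrite big_cons.
rewrite !big_split /= IH !sumr_const card_tuple card_bool.
rewrite -[item true *+ _]mulr_natr -[item false *+ _]mulr_natr natrX exprS.
by rewrite /item -[n.+1%:R]natr1; field.
Qed.

Lemma sum_BF_le K (c : R) n : 0 <= c ->
  (forall I k, (K <= k)%N -> valid_items I -> is_OPT I k -> expected_BF I <= c * k%:R) ->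
  4 * K%:R <= n%:R :> R ->
  \sum_(t : n.-tuple bool) (BF (map item t))%:R <= 2 ^+ n * (c * (7 / 24 * n%:R + 2)).
Proof.
move=> c0 ratio nlarge; rewrite -sum_expected_BF.
apply: (@le_trans _ _ (\sum_(t : n.-tuple bool) c * (\sum_(x <- map item t) x + 2))).
  apply: ler_sum => t _; have [k optk /andP[lek kle]] := is_OPT_word t.
  apply: le_trans (ler_wpM2l c0 kle); apply: ratio optk.
    (* The optimum is at least the total size, hence at least n/4, which puts it in the range
       [K <= k] where the ratio is assumed. *)
    have := total_word_ge t; rewrite size_tuple -(ler_nat R).
    lra.
  by move=> _ /mapP[b _ ->]; case: b; rewrite /item; lra.
rewrite -mulr_sumr big_split /= sum_total_words sumr_const card_tuple card_bool.
rewrite -[2 *+ _]mulr_natr natrX; lra.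
Qed.

(** The limsup is the infimum of the tail suprema, so some tail stays below [c]. The strict [K < k]
    makes [k] positive for the division. *)
Lemma RR_BF_ltP c : (RR_BF R < c%:E)%E -> exists K, forall I k,
  (K < k)%N -> valid_items I -> is_OPT I k -> expected_BF I <= c * k%:R.
Proof.
rewrite /RR_BF limn_esup_lim (cvg_lim _ (@cvg_esups_inf _ _)) // => /ereal_inf_lt.
case=> _ [K _ <-] Kc; exists K => I k Kk validI optk.
have k0 : 0 < k%:R :> R by rewrite ltr0n (leq_ltn_trans _ Kk).
rewrite -ler_pdivrMr // -lee_fin; apply: ltW; apply: le_lt_trans Kc.
apply: (@le_trans _ _ (sup_ratio R k)); first by apply: ereal_sup_ubound; exists I.
by apply: ereal_sup_ubound; exists k => //=; apply: ltnW.
Qed.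
End BestFit.

Theorem theorem4 (R : realType) : ((110%:R / 100%:R : R)%R)%:E < RR_BF R.
Proof.
rewrite ltNge; apply/negP => RRle.
(* (60/187) / (7/24) = 1440/1309 exceeds 11/10 by about 7.6e-5. *)
pose c : R := (11 / 10 + 1 / 100 * (1 / 1000))%R.
have /RR_BF_ltP[K ratio] : RR_BF R < c%:E.
  by apply: le_lt_trans RRle _; rewrite lte_fin /c; lra.
(* The first summand makes [sum_BF_le] applicable with [K.+1]. The second makes the gain, about
   0.0036 per item, outweigh the additive loss 187 * 2 * [c] < 412. *)
pose M : R := (4 * K.+1%:R + 1000 * 1000)%R.
pose n := Num.bound M.
have K0 : (0 <= K.+1%:R :> R)%R by [].
have nM : (M < n%:R)%R by apply: archi_boundP; rewrite /M; lra.
have c0 : (0 <= c)%R by rewrite /c; lra.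
have Kn : (4 * K.+1%:R <= n%:R :> R)%R by rewrite /M in nM; lra.
have := le_trans (sum_BF_ge R n) (ler_wpM2l (ler0n R 187) (sum_BF_le c0 ratio Kn)).
rewrite [X in (_ <= X)%R]mulrCA ler_pM2l ?exprn_gt0 // /c.
by rewrite /M in nM; lra.
Qed.
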